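(* Let $k\geq 3$ be an integer, let $n=k+4$, and let $X=\mathrm{Spider}(2,2,1,\dots,1)$ be the spider with $k+1$ legs (two legs of length $2$ and $k-1$ legs of length $1$), a graph on $n$ vertices. Then the following three friends-and-strangers graphs are connected, where each spider appearing under a complement has exactly $k$ legs (and $n$ vertices): \begin{itemize} \item $\mathrm{FS}(X,\overline{\mathrm{Spider}(2,2,2,1,\dots,1)})$ (three legs of length $2$ and $k-3$ legs of length $1$); \item $\mathrm{FS}(X,\overline{\mathrm{Spider}(3,2,1,\dots,1)})$ (one leg of length $3$, one of length $2$, and $k-2$ legs of length $1$); \item $\mathrm{FS}(X,\overline{\mathrm{Spider}(4,1,\dots,1)})$ (one leg of length $4$ and $k-1$ legs of length $1$). \end{itemize}
   Context: All graphs are finite and simple, and $[n]=\{1,\dots,n\}$. The complement $\overline{G}$ of a graph $G$ has vertex set $V(G)$, and two distinct vertices are adjacent in $\overline{G}$ iff they are not adjacent in $G$. Friends-and-strangers graph: for graphs $X,Y$ with $V(X)=V(Y)=[n]$, $\mathrm{FS}(X,Y)$ is the graph whose vertices are all permutations $\sigma$ of $[n]$ (viewed as bijections $V(X)\to V(Y)$), where $\sigma$ and $\phi$ are adjacent iff there is an edge $\{a,b\}\in E(X)$ such that $\{\sigma(a),\sigma(b)\}\in E(Y)$, $\sigma(a)=\phi(b)$, $\sigma(b)=\phi(a)$, and $\sigma(c)=\phi(c)$ for all $c\in V(X)\setminus\{a,b\}$. Graphs on $n$ vertices are labelled by $[n]$ in any way; connectedness of $\mathrm{FS}(X,Y)$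 does not depend on the labelling. Spider: for positive integers $\lambda_1\geq\cdots\geq\lambda_m$, $\mathrm{Spider}(\lambda_1,\dots,\lambda_m)$ is the graph on $1+\sum_{i=1}^m\lambda_i$ vertices consisting of a center vertex together with $m$ pairwise disjoint paths (legs) having $\lambda_1,\dots,\lambda_m$ vertices respectively (the lengths of the legs), one endpoint of each leg being joined by an edge to the center (and no other edges). *)

(* Defs.v *)
From mathcomp Require Import all_boot all_fingroup.

Set Implicit Arguments.
Unset Strict Implicit.
Unset Printing Implicit Defensive.

Record sgraph (T : finType) := SGraph {
  adj :> rel T;
  adj_sym : symmetric adj;
  adj_irr : irreflexive adj }.

Definition connected (T : finType) (G : sgraph T) : Prop :=
  0 < #|T| /\ forall x y : T, connect G x y.

Definition isomorphic (T U : finType) (G : sgraph T) (H : sgraph U) : Prop :=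
  exists2 f : T -> U, bijective f & forall x y, H (f x) (f y) = G x y.

Section Complement.
Variables (T : finType) (G : sgraph T).

Definition compl_rel : rel T := fun x y => (x != y) && ~~ G x y.

Lemma compl_sym : symmetric compl_rel.
Proof. by move=> x y; rewrite /compl_rel eq_sym adj_sym. Qed.

Lemma compl_irr : irreflexive compl_rel.
Proof. by move=> x; rewrite /compl_rel eqxx. Qed.

Definition compl : sgraph T := SGraph compl_sym compl_irr.

End Complement.

Section FriendsAndStrangers.
Variables (T : finType) (X Y : sgraph T).
Implicit Types s p : {perm T}.

Definition FS_rel : rel {perm T} := fun s p =>
  [exists a, exists b,
    [&& X a b, Y (s a) (s b), s a == p b, s b == p a &
        [forall c, (c \notin [set a; b]) ==> (s c == p c)]]].

Lemma FS_sym : symmetric FS_rel.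
Proof.
have half s p : FS_rel s p -> FS_rel p s.
  case/existsP=> a /existsP[b] /and5P[Xab Yab /eqP sa /eqP sb /forallP sc].
  apply/existsP; exists a; apply/existsP; exists b.
  rewrite Xab -sa -sb adj_sym Yab !eqxx /=.
  by apply/forallP => c; rewrite [p c == _]eq_sym.
by move=> s p; apply/idP/idP; apply: half.
Qed.

Lemma FS_irr : irreflexive FS_rel.
Proof.
move=> s; apply/negbTE/negP=> /existsP[a] /existsP[b] /and5P[Xab _ /eqP /perm_inj ab _ _].
by rewrite ab adj_irr in Xab.
Qed.

Definition FS : sgraph {perm T} := SGraph FS_sym FS_irr.

End FriendsAndStrangers.

Section Spider.
Variable l : seq nat.

(* [l] lists the leg lengths; [None] is the center;
   [Some (Tagged _ j)] with tag [i] is the vertex of the [i]-th leg at distance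
   [j.+1] from the center. *)
Definition spider_vertex : finType :=
  option {i : 'I_(size l) & 'I_(nth 0 l i)}.

Definition spider_rel : rel spider_vertex := fun u v =>
  match u, v with
  | None, None => false
  | None, Some q => tagged q == 0 :> nat
  | Some p, None => tagged p == 0 :> nat
  | Some p, Some q => (tag p == tag q) &&
      (((tagged p).+1 == tagged q :> nat) || ((tagged q).+1 == tagged p :> nat))
  end.

Lemma spider_sym : symmetric spider_rel.
Proof. by case=> [p|] [q|] //=; rewrite [tag p == _]eq_sym orbC. Qed.

Lemma spider_irr : irreflexive spider_rel.
Proof. by case=> [p|] //=; rewrite eqxx orbb gtn_eqF. Qed.

Definition Spider : sgraph spider_vertex := SGraph spider_sym spider_irr.

Lemma card_spider : #|spider_vertex| = (sumn l).+1.
Proof.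
rewrite card_option card_tagged [in LHS]sumnE big_map big_enum [in RHS]sumnE.
rewrite [in RHS](big_nth 0) big_mkord; congr _.+1.
by apply: eq_bigr => i _; rewrite card_ord.
Qed.

End Spider.

(* Main.v *)
Require Import Defs.
From mathcomp Require Import all_boot all_fingroup.
From mathcomp Require Import zify.
From Stdlib Require Import MSetPositive.

Set Implicit Arguments.
Unset Strict Implicit.
Unset Printing Implicit Defensive.

(** The proof is an induction on the number of short legs. In each of the three
    families, passing from [k] to [k + 1] adds one leaf at the center of [X]
    and one leaf [y] at the center [z] of the second spider. Call the vertices
    of the second graph people, two of them being friends when they are not
    adjacent in the spider. The new person [y] is a friend of everybody except
    [z], while [z] has exactly three friends [D], the people at distance at
    least 2 from [z] in the spider.

    Configurations with [y] seated at a given leaf of [X] form a connected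
    set, since deleting that leaf and [y] gives the previous case
    ([connect_lift]), and these sets are joined by moves of [y] from leaf to leaf
    through the center. So it suffices to bring [y] to the center of [X]: from
    there [y] moves on to a leaf ([connected_add_leaf]). Only [z] can stand in
    the way of [y]. If [z] sits at the center, one of its three friends sits
    next to the center, because only two seats of [X] are neither the center
    nor next to it; exchanging [z] with that friend frees the center. If
    [y] is at the end of a long leg and [z] is next to it, a friend of [z] has
    to be brought to the center, so that [z] can leave the leg. The person [h]
    at the center is, if not already a friend of [z], next to [z] in the
    spider, hence fails to be a friend of at most one member of [D]; at
    most one more member of [D] is away from the center, at the end of the
    other long leg, so some member of [D] can be exchanged with [h].

    The induction starts at [n = 7], where each of the three graphs has 5040
    vertices and a verified breadth-first search visits them all. It could not
    start at [n = 6]: there the two graphs that make sense, for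
    Spider(3,2) and Spider(4,1), are disconnected.

    To make the induction smooth, spiders are realized on ['I_n] in such a way
    that adding a leaf at the center adds the vertex [n]: the vertices are
    numbered leg by leg, long legs first, and the spider is determined by the
    list [D] of the vertices that are attached to their predecessor rather
    than to the center 0 ([flat_spider], [Spider_flat]). *)

(** * Moves and transport *)

Lemma connect_homo (S T : finType) (e : rel S) (e' : rel T) (f : S -> T) :
  {homo f : x y / e x y >-> e' x y} ->
  {homo f : x y / connect e x y >-> connect e' x y}.
Proof.
move=> hf x y /connectP[p e_p ->]; apply/connectP.
by exists (map f p); [apply: homo_path e_p | rewrite last_map].
Qed.

Section Moves.
Variables (T : finType) (X Y : sgraph T).
Implicit Types s t : {perm T}.

(** Adjacency as a move: the people on an edge [a, b] of [X] exchange seats. *)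
Lemma FS_relP s t :
  reflect (exists a b, [/\ X a b, Y (s a) (s b) & t = (tperm a b * s)%g])
          (FS X Y s t).
Proof.
apply: (iffP idP) => [|[a [b [Xab Yab ->]]]].
  case/existsP=> a /existsP[b] /and5P[Xab Yab /eqP sa /eqP sb /forallP sc].
  exists a, b; split=> //; apply/permP=> c; rewrite permM.
  case: tpermP => [->|->|/eqP ca /eqP cb]; [by rewrite -sb|by rewrite -sa|].
  by have /implyP/(_ _)/eqP-> // := sc c; rewrite !inE negb_or ca.
apply/existsP; exists a; apply/existsP; exists b.
rewrite Xab Yab !permM tpermL tpermR !eqxx /=.
apply/forallP=> c; rewrite !inE negb_or permM; apply/implyP=> /andP[ca cb].
by rewrite tpermD // eq_sym.
Qed.

Lemma connect_swap s a b :
  X a b -> Y (s a) (s b) -> connect (FS X Y) s (tperm a b * s)%g.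
Proof. by move=> Xab Yab; apply/connect1/FS_relP; exists a, b. Qed.

Lemma connect_FS_sym : connect_sym (FS X Y).
Proof. exact/sym_connect_sym/FS_sym. Qed.

Lemma FS_connectedP :
  (forall s t, connect (FS X Y) s t) <-> connected (FS X Y).
Proof.
by split=> [cXY|[]//]; split=> //; apply/card_gt0P; exists 1%g.
Qed.

End Moves.

Lemma isomorphic_trans (T U V : finType) (G : sgraph T) (H : sgraph U)
    (K : sgraph V) :
  isomorphic G H -> isomorphic H K -> isomorphic G K.
Proof.
move=> [f bij_f fE] [g bij_g gE]; exists (g \o f); first exact: bij_comp.
by move=> x y; rewrite /= gE fE.
Qed.

Lemma isomorphic_compl (T U : finType) (G : sgraph T) (H : sgraph U) :
  isomorphic G H -> isomorphic (compl G) (compl H).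
Proof.
move=> [f bij_f fE]; exists f => // x y.
by rewrite /= /compl_rel fE (bij_eq bij_f).
Qed.

(** With [f] relabelling positions and [g] relabelling people, a configuration
    [s] of the second pair of graphs becomes [g^-1 \o s \o f], and moves become
    moves. *)
Lemma connected_FS_iso (T U : finType) (X Y : sgraph T) (X' Y' : sgraph U) :
  isomorphic X X' -> isomorphic Y Y' ->
  connected (FS X' Y') -> connected (FS X Y).
Proof.
move=> [f [f' fK f'K] fE] [g [g' gK g'K] gE] /FS_connectedP cXY.
have inj_phi (s : {perm U}) : injective (g' \o s \o f).
  exact: inj_comp (inj_comp (can_inj g'K) (@perm_inj _ s)) (can_inj fK).
have inj_psi (s : {perm T}) : injective (g \o s \o f').
  exact: inj_comp (inj_comp (can_inj gK) (@perm_inj _ s)) (can_inj f'K).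
pose phi s := perm (inj_phi s); pose psi s := perm (inj_psi s).
have psiK s : phi (psi s) = s.
  by apply/permP=> x; rewrite permE /= permE /= fK gK.
apply/FS_connectedP=> s t; rewrite -[s]psiK -[t]psiK.
apply: connect_homo (cXY (psi s) (psi t)) => {s t}.
move=> s _ /FS_relP[a [b [Xab Yab ->]]]; apply/FS_relP; exists (f' a), (f' b).
rewrite -fE !f'K Xab !permE /= !f'K -gE !g'K Yab; split=> //.
apply/permP=> x; rewrite permM [LHS]permE [RHS]permE /= permM.
by rewrite (inj_tperm _ _ _ (can_inj fK)) !f'K.
Qed.

(** Configurations that agree on seating [y] at [x] are configurations of the
    graphs with [x] and [y] deleted, and moves of the smaller graphs are moves of
    the larger ones in which [y] stays put. *)
Lemma connect_lift n (X Y : sgraph 'I_n.+1) (X' Y' : sgraph 'I_n)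
    (x y : 'I_n.+1) (s t : {perm 'I_n.+1}) :
  (forall a b, X (lift x a) (lift x b) = X' a b) ->
  (forall a b, Y (lift y a) (lift y b) = Y' a b) ->
  connected (FS X' Y') -> s x = y -> t x = y -> connect (FS X Y) s t.
Proof.
move=> XE YE /FS_connectedP cXY.
have lift_permP (r : {perm 'I_n.+1}) : r x = y ->
    exists r' : {perm 'I_n}, r = lift_perm x y r'.
  move=> rx; pose g i := odflt i (unlift y (r (lift x i))).
  have gE i : lift y (g i) = r (lift x i).
    rewrite /g; case: unliftP => //= ri.
    by have := neq_lift x i; rewrite -(inj_eq (@perm_inj _ r)) rx ri eqxx.
  have inj_g : injective g.
    move=> i j gij; apply/(@lift_inj _ x)/(@perm_inj _ r).
    by rewrite -!gE gij.
  exists (perm inj_g); apply/permP=> i.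
  case: (unliftP x i) => [j|] ->; last by rewrite lift_perm_id.
  by rewrite lift_perm_lift permE gE.
move=> /lift_permP[s' ->] /lift_permP[t' ->].
apply: connect_homo (cXY s' t') => {s t s' t'}.
move=> s _ /FS_relP[a [b [Xab Yab ->]]].
apply/FS_relP; exists (lift x a), (lift x b).
rewrite XE !lift_perm_lift YE; split=> //; apply/permP=> i; rewrite permM.
case: (unliftP x i) => [j|] ->.
  by rewrite -(inj_tperm _ _ _ (@lift_inj _ x)) !lift_perm_lift permM.
by rewrite tpermD ?lift_perm_id // eq_sym neq_lift.
Qed.

Lemma perm_through (T : finType) (a b a' b' : T) :
  a != b -> a' != b' -> exists s : {perm T}, s a = a' /\ s b = b'.
Proof.
move=> ab ab'; exists (tperm a a' * tperm (tperm a a' b) b')%g.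
rewrite !permM tpermL tpermL tpermD // 1?eq_sym //.
by rewrite -{1}(tpermL a a') inj_eq //; apply: perm_inj.
Qed.

(** * Spiders on an initial segment of the naturals *)

(** The neighbor of [v] on the way to the center 0: [D] lists the vertices at
    distance at least 2 from the center, whose leg is numbered consecutively.
    At [v = 0] the value is a dummy, discarded by [flat_adj]. *)
Definition flat_parent (D : seq nat) (v : nat) := if v \in D then v.-1 else 0.

Definition flat_adj (D : seq nat) (u v : nat) :=
  (0 < v) && (u == flat_parent D v) || (0 < u) && (v == flat_parent D u).

Section FlatSpider.
Variables (D : seq nat) (n : nat).

Definition flat_rel : rel 'I_n := fun u v => flat_adj D u v.

Lemma flat_sym : symmetric flat_rel.
Proof. by move=> u v; rewrite /flat_rel /flat_adj orbC. Qed.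

Lemma flat_irr : irreflexive flat_rel.
Proof.
move=> u; rewrite /flat_rel /flat_adj orbb /flat_parent.
by case: ifP => _; lia.
Qed.

Definition flat_spider : sgraph 'I_n := SGraph flat_sym flat_irr.

End FlatSpider.

(** Deleting a leaf [x] numbered after all long legs does not disturb [D], so
    the result is the flat spider of the same shape. *)
Lemma flat_lift D n (x : 'I_n.+1) (a b : 'I_n) :
  0 < x -> all (gtn x) D ->
  flat_spider D n.+1 (lift x a) (lift x b) = flat_spider D n a b.
Proof.
move=> x0 /allP Dx; rewrite /= /flat_rel /flat_adj /=.
have D_bump c : (bump x c \in D) = (c \in D).
  rewrite /bump; case: leqP => //= xc; rewrite add1n.
  by apply/idP/idP=> /Dx /=; lia.
have parentE c : flat_parent D (bump x c) = bump x (flat_parent D c).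
  rewrite /flat_parent D_bump; case: ifP => [/Dx /=|_]; rewrite /bump; lia.
rewrite !parentE !(inj_eq (can_inj (bumpK x))) /bump.
by congr (_ && _ || _ && _); lia.
Qed.

(** Numbering the center 0 and then the legs one after the other gives vertex
    [j] of leg [i] the number [(flatten_index l i j).+1]. *)
Lemma Spider_flat l D n :
  n = (sumn l).+1 ->
  (forall i j, j < nth 0 l i -> ((flatten_index l i j).+1 \in D) = (0 < j)) ->
  isomorphic (Spider l) (flat_spider D n).
Proof.
move=> -> DP.
pose pos (p : spider_vertex l) : nat :=
  if p is Some q then (flatten_index l (tag q) (tagged q)).+1 else 0.
have posP p : pos p < (sumn l).+1.
  by case: p => [[i j]|] //=; rewrite ltnS flatten_indexP.
have idx_inj i j i' j' : j < nth 0 l i -> j' < nth 0 l i' ->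
    flatten_index l i j = flatten_index l i' j' -> i = i' /\ j = j'.
  move=> jl jl' e; split.
    by rewrite -(flatten_indexKl jl) e flatten_indexKl.
  by rewrite -(flatten_indexKr jl) e flatten_indexKr.
exists (fun p => Ordinal (posP p)).
  apply: inj_card_bij; last by rewrite card_spider card_ord.
  move=> [[i j]|] [[i' j']|] // [] // e.
  have [/val_inj ii] := idx_inj _ _ _ _ (ltn_ord j) (ltn_ord j') e.
  by case: _ / ii j' {e} => j' /val_inj ->.
have parentE i j : j < nth 0 l i ->
    flat_parent D (flatten_index l i j).+1 =
    if j is j'.+1 then (flatten_index l i j').+1 else 0.
  move=> jl; rewrite /flat_parent DP //; case: j jl => //= j jl.
  by rewrite /flatten_index addnS.
(* Both adjacency relations are symmetrized versions of this one. *)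
have half (i i' : 'I_(size l)) (j : 'I_(nth 0 l i)) (j' : 'I_(nth 0 l i')) :
    ((flatten_index l i j).+1 == flat_parent D (flatten_index l i' j').+1) =
    (i == i') && (j.+1 == j').
  rewrite parentE //; case: j' => [[|j'] j'l] /=; first by rewrite andbF.
  rewrite !eqSS; apply/eqP/andP => [e|[/eqP ii /eqP ->]]; last by rewrite ii.
  have [ii ->] := idx_inj _ _ _ _ (ltn_ord j) (ltnW j'l) e.
  by rewrite -val_eqE /= ii !eqxx.
move=> [[i j]|] [[i' j']|]; rewrite /= /flat_rel /flat_adj //=.
- by rewrite !half [i' == i]eq_sym andb_orr.
- by rewrite parentE //=; case: (nat_of_ord j).
- by rewrite parentE // orbF; case: (nat_of_ord j').
Qed.

(** * Seven vertices *)

(** Configurations as computable data: the list of the people by position. *)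
Definition word n (s : {perm 'I_n}) : seq nat :=
  [seq val (s i) | i <- enum 'I_n].

Definition swap_entries (w : seq nat) (a b : nat) : seq nat :=
  mkseq (fun i => nth 0 w (if i == a then b else if i == b then a else i))
        (size w).

(** In a flat spider the edges are the pairs [flat_parent E b, b] with
    [0 < b]. *)
Definition moves (E D : seq nat) (w : seq nat) : seq (seq nat) :=
  [seq swap_entries w (flat_parent E b) b |
     b <- iota 1 (size w).-1 &
     let u := nth 0 w (flat_parent E b) in let v := nth 0 w b in
     (u != v) && ~~ flat_adj D u v].

(** An injective code of words, so that the visited words can be kept in a
    binary trie: each letter is written in unary, with [xO] closing it. *)
Fixpoint code (w : seq nat) : BinNums.positive :=
  if w is x :: w' then iter x BinNums.xI (BinNums.xO (code w'))
  else BinNums.xH.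

Definition visit (w : seq nat) (acc : PositiveSet.t * seq (seq nat)) :=
  if PositiveSet.mem (code w) acc.1 then acc
  else (PositiveSet.add (code w) acc.1, w :: acc.2).

Definition layer (E D : seq nat) (acc : PositiveSet.t * seq (seq nat)) :=
  foldr visit (acc.1, [::]) (flatten (map (moves E D) acc.2)).

(** [k] layers of a breadth-first search from the identity. *)
Definition explore (E D : seq nat) (n k : nat) :=
  iter k (layer E D) (visit (iota 0 n) (PositiveSet.empty, [::])).

Definition explores_all (E D : seq nat) (n k : nat) :=
  let t := (explore E D n k).1 in
  all (fun w => PositiveSet.mem (code w) t) (permutations (iota 0 n)).

Lemma size_word n (s : {perm 'I_n}) : size (word s) = n.
Proof. by rewrite size_map size_enum_ord. Qed.

Lemma nth_word n (s : {perm 'I_n}) (i : 'I_n) : nth 0 (word s) i = s i.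
Proof. by rewrite (nth_map i) ?size_enum_ord // nth_ord_enum. Qed.

Lemma word1 n : word (1 : {perm 'I_n})%g = iota 0 n.
Proof.
by rewrite -val_enum_ord; apply: eq_map => i; rewrite perm1.
Qed.

Lemma word_inj n : injective (@word n).
Proof.
move=> s t st; apply/permP=> i; apply/val_inj.
by rewrite /= -!nth_word st.
Qed.

Lemma word_permutations n (s : {perm 'I_n}) :
  word s \in permutations (iota 0 n).
Proof.
rewrite mem_permutations; apply: uniq_perm; last 1 first.
- move=> i; rewrite mem_iota /=; apply/mapP/idP => [[j _ ->]|i_n].
    exact: ltn_ord.
  by exists ((s^-1)%g (Ordinal i_n)); rewrite ?mem_enum ?permKV.
- rewrite map_inj_uniq ?enum_uniq // => i j /val_inj; exact: perm_inj.
- exact: iota_uniq.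
Qed.

Lemma word_swap n (s : {perm 'I_n}) (a b : 'I_n) :
  word (tperm a b * s)%g = swap_entries (word s) a b.
Proof.
apply: (@eq_from_nth _ 0) => [|i]; first by rewrite size_mkseq !size_word.
rewrite size_word => i_n; rewrite nth_mkseq ?size_word //.
rewrite (nth_word _ (Ordinal i_n)) permM -nth_word; congr nth.
case: tpermP => [<-|ib|/eqP ia /eqP ib] /=; first by rewrite eqxx.
  by rewrite -ib /= eqxx; case: eqP => // ->.
by rewrite -[i]/(val (Ordinal i_n)) !val_eqE (negbTE ia) (negbTE ib).
Qed.

Lemma code_inj : injective code.
Proof.
elim=> [|x w IHw] [|y v] /=; [by []|by case: y|by case: x|].
by elim: x y => [|x IHx] [|y] //= [] => [/IHw->|/IHx[-> ->]].
Qed.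

(** The search is trusted in one direction only: every code in the table and
    every word on the frontier come from configurations connected to the
    identity. That nothing was missed is then observed by [explores_all]. *)
Lemma explore_sound E D n k w :
  PositiveSet.mem (code w) (explore E D n k).1 ->
  exists2 s : {perm 'I_n}, word s = w &
    connect (FS (flat_spider E n) (compl (flat_spider D n))) 1%g s.
Proof.
set R := connect _.
pose ok w := exists2 s : {perm 'I_n}, word s = w & R 1%g s.
pose sound (acc : PositiveSet.t * seq (seq nat)) :=
  (forall p, PositiveSet.mem p acc.1 -> exists2 w, code w = p & ok w) /\
  (forall w, w \in acc.2 -> ok w).
have visit_ok w' acc : ok w' -> sound acc -> sound (visit w' acc).
  move=> okw [tab fr]; rewrite /visit; case: ifP => // _; split=> /= [p|v].
    move/PositiveSet.add_spec => [->|/tab //]; by exists w'.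
  by rewrite inE => /predU1P[->|/fr].
have moves_ok v w' : ok v -> w' \in moves E D v -> ok w'.
  move=> [s <- Rs] /mapP[b]; rewrite mem_filter mem_iota size_word.
  move=> /andP[/andP[uv Fuv] /andP[b0 bn]] ->.
  have b_n : b < n by lia.
  have a_n : flat_parent E b < n by rewrite /flat_parent; case: ifP; lia.
  pose bo := Ordinal b_n; pose ao := Ordinal a_n.
  exists (tperm ao bo * s)%g; first exact: word_swap.
  apply: connect_trans Rs _; apply: connect_swap.
    by rewrite /= /flat_rel /flat_adj /= b0 eqxx.
  move: uv Fuv; rewrite -[b]/(val bo) -[flat_parent _ _]/(val ao) !nth_word.
  by rewrite /= /compl_rel -val_eqE => -> .
have layer_ok acc : sound acc -> sound (layer E D acc).
  move=> [tab fr]; rewrite /layer.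
  have: forall w', w' \in flatten (map (moves E D) acc.2) -> ok w'.
    by move=> w' /flatten_mapP[v /fr okv]; apply: moves_ok.
  elim: (flatten _) => [|w' ws IH] // okws /=.
  apply: visit_ok; first by apply: okws; rewrite mem_head.
  by apply: IH => v vws; apply: okws; rewrite inE vws orbT.
have [tab _] : sound (explore E D n k).
  rewrite /explore; elim: k => [|k IH]; last exact: layer_ok.
  apply: visit_ok => //; exists 1%g; [exact: word1|exact: connect0].
by move=> /tab[v /code_inj ->].
Qed.

Lemma connected_explores_all E D n k :
  explores_all E D n k ->
  connected (FS (flat_spider E n) (compl (flat_spider D n))).
Proof.
move=> /allP all_w.
have R1 s : connect (FS (flat_spider E n) (compl (flat_spider D n))) 1%g s.
  have [t /word_inj <-//] := explore_sound (all_w _ (word_permutations s)).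
apply/FS_connectedP => s t; apply: connect_trans (R1 t).
by rewrite connect_FS_sym.
Qed.

(** The bound 30 on the number of layers exceeds the eccentricity of the
    identity in all three graphs on 7 vertices. *)
Lemma connected_flat7_222 :
  connected (FS (flat_spider [:: 2; 4] 7) (compl (flat_spider [:: 2; 4; 6] 7))).
Proof. by apply: (@connected_explores_all _ _ _ 30); vm_compute. Qed.

Lemma connected_flat7_321 :
  connected (FS (flat_spider [:: 2; 4] 7) (compl (flat_spider [:: 2; 3; 5] 7))).
Proof. by apply: (@connected_explores_all _ _ _ 30); vm_compute. Qed.

Lemma connected_flat7_411 :
  connected (FS (flat_spider [:: 2; 4] 7) (compl (flat_spider [:: 2; 3; 4] 7))).
Proof. by apply: (@connected_explores_all _ _ _ 30); vm_compute. Qed.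

(** * Adding a leaf to both spiders *)

Lemma pigeonhole (T : eqType) (s r : seq T) :
  uniq s -> size r < size s -> exists2 x, x \in s & x \notin r.
Proof.
move=> uniq_s lt_rs; have [/allP sub_sr|] := boolP (all (mem r) s).
  by have := uniq_leq_size uniq_s sub_sr; rewrite leqNgt lt_rs.
by rewrite -has_predC => /hasP.
Qed.

(** Position 0 is the center of [X], whose long legs are [1, 2] and [3, 4]. The
    people are [z], the center of the second spider, [y], its new leaf, and the
    three friends [D] of [z]. *)
Section AddLeaf.
Variables (n : nat) (D : seq nat).
Hypotheses (n7 : 6 < n) (uniq_D : uniq D) (size_D : size D = 3).
Hypothesis D_range : all (fun d => 1 < d < 7) D.

Let X := flat_spider [:: 2; 4] n.+1.
Let F := compl (flat_spider D n.+1).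
Let z : 'I_n.+1 := ord0.
Let y : 'I_n.+1 := ord_max.
Implicit Types (s t : {perm 'I_n.+1}) (p q u v : 'I_n.+1).

Let D_lt d : d \in D -> 1 < d < 7.
Proof. by move/(allP D_range). Qed.

Let X0 p : X ord0 p = [&& p != ord0, p != 2 :> nat & p != 4 :> nat].
Proof.
rewrite /= /flat_rel /flat_adj /flat_parent !inE -!val_eqE /= orbF.
by case: p => [[|[|[|[|[|p]]]]]].
Qed.

Let F_y v : v != z -> v != y -> F y v.
Proof.
move=> vz vy; rewrite /= /compl_rel eq_sym vy /=.
rewrite /flat_rel /flat_adj /flat_parent; move: vz vy; rewrite -!val_eqE /= => v0 vn; have := ltn_ord v.
case: ifP => [/D_lt|_]; case: ifP => [/D_lt|_]; lia.
Qed.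

Let F_z v : F z v = (nat_of_ord v \in D).
Proof.
rewrite /= /compl_rel /= /flat_rel /flat_adj /flat_parent -val_eqE /=.
by case: ifP => [/D_lt|_]; lia.
Qed.

Let z_notD : (nat_of_ord z \in D) = false.
Proof. by apply/negP => /D_lt. Qed.

Let y_notD : (nat_of_ord y \in D) = false.
Proof. by apply/negP => /D_lt /andP[_]; rewrite ltnNge n7. Qed.

Let yz : y != z.
Proof. by rewrite -val_eqE /=; case: n n7. Qed.

Let reaches s := exists2 t, connect (FS X F) s t & t z = y.

Let reaches_swap s p q :
  X p q -> F (s p) (s q) -> reaches (tperm p q * s)%g -> reaches s.
Proof.
move=> Xpq Fpq [t st ty]; exists t => //; apply: connect_trans st.
exact: connect_swap.
Qed.

(** [z] has three friends, so one of them avoids any two given people. *)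
Let friend_seat s (r : seq nat) : size r < 3 ->
  exists2 q, nat_of_ord (s q) \in D & nat_of_ord (s q) \notin r.
Proof.
rewrite -size_D => /(pigeonhole uniq_D)[d dD dr].
have d_n : d < n.+1 by have := D_lt dD; lia.
by exists ((s^-1)%g (Ordinal d_n)); rewrite permKV.
Qed.

Let reach_free s p : X z p -> s p = y -> s z != z -> reaches s.
Proof.
move=> Xp sp sz; apply: (reaches_swap Xp).
  rewrite sp adj_sym F_y // -sp (inj_eq perm_inj) eq_sym.
  by move: Xp; rewrite X0 => /and3P[].
by exists (tperm z p * s)%g => //; rewrite permM tpermL.
Qed.

(** If [z] blocks the center, one of its three friends is next to it, as only
    the two seats 2 and 4 are farther away; [z] leaves by exchanging with that
    friend. *)
Let reach_inner s p : X z p -> s p = y -> reaches s.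
Proof.
move=> Xp sp; case: (eqVneq (s z) z) => [sz|]; last exact: (reach_free Xp sp).
have two : 2 < n.+1 by lia.
have four : 4 < n.+1 by lia.
pose r := [:: val (s (Ordinal two)); val (s (Ordinal four))].
have [q qD] := friend_seat s (r := r) isT.
rewrite !inE negb_or !val_eqE !(inj_eq perm_inj) -!val_eqE /= => /andP[q2 q4].
have qz : q != z by apply: contraTneq qD => ->; rewrite sz z_notD.
have Xq : X z q by rewrite X0 qz q2.
have qp : q != p by apply: contraTneq qD => ->; rewrite sp y_notD.
have pz : p != z by move: Xp; rewrite X0 => /and3P[].
apply: (reaches_swap Xq); first by rewrite sz F_z.
apply: (reach_free (p := p)) => //; rewrite permM.
  by rewrite tpermD // eq_sym.
by rewrite tpermL -sz (inj_eq perm_inj).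
Qed.

(** Here [z] may sit between [y] and the center. It leaves the leg through the
    center as soon as a friend of [z] is there, which one exchange achieves. *)
Let reach_outer s u p :
  X z u -> X u p -> p = 2 :> nat \/ p = 4 :> nat -> s p = y -> reaches s.
Proof.
move=> Xu Xup p24 sp.
have uz : u != z by move: Xu; rewrite X0 => /and3P[].
have pz : p != z by case: p24 => pE; rewrite -val_eqE /= pE.
have pu : p != u by apply: contraTneq Xup => ->; rewrite adj_irr.
have uninner t : t p = y -> t u != z -> reaches t.
  move=> tp tu; apply: (reaches_swap Xup).
    by rewrite tp adj_sym F_y // -tp (inj_eq perm_inj) eq_sym.
  by apply: (reach_inner (p := u)) => //; rewrite permM tpermL.
have [su|] := eqVneq (s u) z; last exact: uninner.
have center t : t p = y -> t u = z -> F z (t z) -> reaches t.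
  move=> tp tu Fz; apply: (reaches_swap Xu); first by rewrite tu adj_sym.
  apply: uninner; rewrite permM; first by rewrite tpermD // eq_sym.
  by rewrite tpermR -{2}tu (inj_eq perm_inj) eq_sym.
have [Fh|Fh] := boolP (F z (s z)); first exact: center.
(* The end of the other long leg is 6 - p. A friend q of z seated next to the
   center fails to be a friend of s z only if it is the successor of s z on
   its leg. *)
have p'P : 6 - p < n.+1 by rewrite (leq_ltn_trans (leq_subr p 6)) // ltnW.
have [q qD] := friend_seat s (r := [:: val (s (Ordinal p'P)); (s z).+1]) isT.
rewrite !inE negb_or val_eqE (inj_eq perm_inj) => /andP[qp' qh].
have qz : q != z by apply: contraNneq Fh => e; rewrite F_z -e.
have qu : q != u by apply: contraTneq qD => ->; rewrite su z_notD.
have qp : q != p by apply: contraTneq qD => ->; rewrite sp y_notD.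
have Xq : X z q.
  rewrite X0 qz; move: qp qp' p24; rewrite -!val_eqE /=; clear; lia.
have hz : s z != z by rewrite -{2}su (inj_eq perm_inj) eq_sym.
apply: (reaches_swap Xq).
  rewrite /= /compl_rel (inj_eq perm_inj) eq_sym qz /=.
  rewrite /flat_rel /flat_adj /flat_parent qD; rewrite F_z in Fh.
  rewrite (negbTE Fh); move: (D_lt qD) qh; clear; lia.
apply: center; rewrite permM.
- by rewrite tpermD // eq_sym.
- by rewrite tpermD // eq_sym.
- by rewrite tpermL F_z.
Qed.

Let reach_all s : reaches s.
Proof.
pose p := (s^-1)%g y; have sp : s p = y by rewrite permKV.
have [pz|pz] := eqVneq p z; first by exists s; rewrite ?connect0 // -pz.
have [Xp|] := boolP (X z p); first exact: reach_inner sp.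
rewrite X0 pz /= -negb_or negbK => p24.
have u_n : p.-1 < n.+1 by have := ltn_ord p; lia.
apply: (reach_outer (u := Ordinal u_n) (p := p)) => //.
- by rewrite X0 -val_eqE /=; lia.
- by rewrite /= /flat_rel /flat_adj /flat_parent !inE p24 eqxx andbT; lia.
- by case/orP: p24 => /eqP; [left|right].
Qed.

Lemma connected_add_leaf :
  connected (FS (flat_spider [:: 2; 4] n) (compl (flat_spider D n))) ->
  connected (FS X F).
Proof.
move=> IH.
have five : 5 < n.+1 by lia.
have six : 6 < n.+1 by lia.
pose x5 := Ordinal five; pose x6 := Ordinal six.
have class x s t : 4 < nat_of_ord x -> s x = y -> t x = y ->
    connect (FS X F) s t.
  move=> x4; apply: connect_lift IH => a b.
    by apply: flat_lift => //=; lia.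
  rewrite /= /compl_rel (inj_eq lift_inj).
  congr (_ && ~~ _); apply: flat_lift => /=; first by lia.
  by apply/allP=> d /D_lt /=; lia.
have X_leaf (x : 'I_n.+1) : 4 < x -> X z x.
  by rewrite X0 -val_eqE /=; lia.
have drop t x : t z = y -> 4 < nat_of_ord x -> t x != z ->
    connect (FS X F) t (tperm z x * t)%g.
  move=> tz x4 tx; apply: connect_swap; first exact: X_leaf.
  rewrite tz F_y // -tz (inj_eq perm_inj) -val_eqE /=; lia.
(* From the center, y goes to leaf 5 unless z is there. In that case y goes to
   leaf 6, the others are rearranged so that z sits at 1, out of the way, and y
   comes back to leaf 5. *)
have to5 s : exists2 t, connect (FS X F) s t & t x5 = y.
  have [t st tz] := reach_all s.
  have [t5|t5] := eqVneq (t x5) z; last first.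
    exists (tperm z x5 * t)%g; last by rewrite permM tpermR.
    exact: connect_trans st (drop _ _ _ _ _).
  have t6 : t x6 != z by rewrite -t5 (inj_eq perm_inj).
  have one : 1 < n.+1 by lia.
  have [r [r6 r1]] := @perm_through _ x6 (Ordinal one) y z isT yz.
  have rE : (tperm z x6 * (tperm z x6 * r))%g = r by rewrite mulgA tperm2 mul1g.
  exists (tperm z x5 * (tperm z x6 * r))%g; last by rewrite !permM tpermR tpermL.
  apply: connect_trans st _; apply: connect_trans (drop _ x6 tz isT t6) _.
  apply: (connect_trans (y := r)).
    by apply: (class x6) => //; rewrite permM tpermR.
  apply: (connect_trans (y := (tperm z x6 * r)%g)).
    rewrite connect_FS_sym -{2}rE; apply: drop => //; rewrite permM ?tpermL //.
    by rewrite tpermR -{2}r1 (inj_eq perm_inj).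
  apply: drop => //; rewrite permM ?tpermL //.
  by rewrite tpermD // -r1 (inj_eq perm_inj).
apply/FS_connectedP => s t.
have [s' ss' s5] := to5 s; have [t' tt' t5] := to5 t.
apply: connect_trans ss' _; rewrite connect_FS_sym; apply: connect_trans tt' _.
exact: (class x5).
Qed.

End AddLeaf.

Lemma connected_flat D n :
  uniq D -> size D = 3 -> all (fun d => 1 < d < 7) D -> 6 < n ->
  connected (FS (flat_spider [:: 2; 4] 7) (compl (flat_spider D 7))) ->
  connected (FS (flat_spider [:: 2; 4] n) (compl (flat_spider D n))).
Proof.
move=> uD sD rD n7 base; rewrite -(subnKC n7).
elim: (n - 7) => [|m IH]; first by rewrite addn0.
by rewrite addnS; apply: connected_add_leaf => //; rewrite leq_addr.
Qed.

(** Legs of length 1 put at the end of [l] add nothing to [D]. *)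
Lemma Spider_flat_leaves l D m n :
  n = (sumn l + m).+1 ->
  (forall i j, i < size l -> j < nth 0 l i ->
     ((flatten_index l i j).+1 \in D) = (0 < j)) ->
  all (fun d => d <= sumn l) D ->
  isomorphic (Spider (l ++ nseq m 1)) (flat_spider D n).
Proof.
move=> nE DP /allP D_le; apply: Spider_flat.
  by rewrite sumn_cat sumn_nseq mul1n.
move=> i j; rewrite nth_cat nth_nseq /flatten_index take_cat.
case: (ltnP i (size l)) => [il|_]; first exact: DP.
case: ifP => // _; case: j => // _; rewrite sumn_cat addn0.
by apply/negbTE/negP => /D_le; rewrite ltnNge leq_addr.
Qed.

Theorem theorem4p3 (k n : nat) (X : sgraph 'I_n) :
  3 <= k -> n = k + 4 ->
  isomorphic X (Spider ([:: 2; 2] ++ nseq (k - 1) 1)) ->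
  [/\ forall Y : sgraph 'I_n,
        isomorphic Y (Spider ([:: 2; 2; 2] ++ nseq (k - 3) 1)) ->
        connected (FS X (compl Y)),
      forall Y : sgraph 'I_n,
        isomorphic Y (Spider ([:: 3; 2] ++ nseq (k - 2) 1)) ->
        connected (FS X (compl Y))
    & forall Y : sgraph 'I_n,
        isomorphic Y (Spider (4 :: nseq (k - 1) 1)) ->
        connected (FS X (compl Y))].
Proof.
move=> k3 nk XE.
have reduce l D m :
    connected (FS (flat_spider [:: 2; 4] 7) (compl (flat_spider D 7))) ->
    sumn l + m = k + 3 ->
    (forall i j, i < size l -> j < nth 0 l i ->
       ((flatten_index l i j).+1 \in D) = (0 < j)) ->
    all (fun d => d <= sumn l) D ->
    uniq D -> size D = 3 -> all (fun d => 1 < d < 7) D ->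
  forall Y : sgraph 'I_n, isomorphic Y (Spider (l ++ nseq m 1)) ->
    connected (FS X (compl Y)).
  move=> base lm DP Dl uD sD rD Y YE.
  apply: (connected_FS_iso (X' := flat_spider [:: 2; 4] n)
                           (Y' := compl (flat_spider D n))).
  - apply: isomorphic_trans XE (Spider_flat_leaves _ _ _) => //=; first by lia.
    by move=> [|[|i]] // [|[|j]].
  - by apply/isomorphic_compl/(isomorphic_trans YE)/Spider_flat_leaves => //; lia.
  - by apply: connected_flat => //; lia.
split.
- apply: (reduce [:: 2; 2; 2] [:: 2; 4; 6] _ connected_flat7_222) => //=.
    by lia.
  by move=> [|[|[|i]]] // [|[|j]].
- apply: (reduce [:: 3; 2] [:: 2; 3; 5] _ connected_flat7_321) => //=.
    by lia.
  by move=> [|[|i]] // [|[|[|j]]].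
- apply: (reduce [:: 4] [:: 2; 3; 4] _ connected_flat7_411) => //=.
    by lia.
  by move=> [|i] // [|[|[|[|j]]]].
Qed.
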